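(* Let $(R,\mathfrak{m})\subset(\widetilde R,\mathfrak{n})$ be an extension of local rings, where $R$ is a $1$-dimensional Cohen-Macaulay local ring with canonical module $\omega_R$, $\widetilde R$ is a finite $R$-module and a discrete valuation ring such that $\widetilde R\subseteq Q(R)$, and the inclusion map $R\to\widetilde R$ induces an isomorphism $R/\mathfrak{m}\to\widetilde R/\mathfrak{n}$. Then for any ideal $I\subset R$ one has $\mathcal{C}_{\widetilde R/R}\subseteq\operatorname{tr}(I)$. In particular, $\mathcal{C}_{\widetilde R/R}\subseteq\operatorname{tr}(\omega_R)$.
   Context: $Q(R)$ is the total ring of fractions of $R$ (a field here, since $R$ is contained in the domain $\widetilde R$ and so is itself a domain). The conductor of the extension is $\mathcal{C}_{\widetilde R/R}=\{x\in R: x\widetilde R\subseteq R\}$, which is an ideal of both $R$ and $\widetilde R$. For an $R$-module $N$, the trace of $N$ is the ideal $\operatorname{tr}(N)=\sum_{\varphi\in\operatorname{Hom}_R(N,R)}\varphi(N)$ of $R$.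
   Formalization: The ideal I is assumed to be nonzero: for I = 0 the trace is 0, while the conductor is nonzero (e.g. R = k[[t^2,t^3]] in k[[t]]), so the claim for any ideal fails there. *)

(* Defs.v *)
From HB Require Import structures.
From mathcomp Require Import all_boot all_algebra.
From mathcomp Require Import boolp classical_sets.

Set Implicit Arguments.
Unset Strict Implicit.
Unset Printing Implicit Defensive.

Import GRing.Theory.
Local Open Scope ring_scope.
Local Open Scope quotient_scope.

(* Ideals.  An arbitrary ideal of [R] is an [R]-submodule of [R^o], i.e. a term
   of type [submodClosed R^o]; [idealr R] is the library's type of proper
   ideals and [prime_idealr R] that of prime ideals.  All three are boolean
   predicates, which classically is no restriction. *)

(* A submodule, in particular an ideal, as a module in its own right. *)
Section Submodule.
Variables (R : comNzRingType) (V : lmodType R) (W : submodClosed V).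

Record submod : Type := Submod {
  submod_val : V;
  submod_valP : submod_val \in W
}.
HB.instance Definition _ := [isSub for submod_val].
HB.instance Definition _ := [Choice of submod by <:].
HB.instance Definition _ := [SubChoice_isSubLmodule of submod by <:].
End Submodule.

Section Rings.
Variable R : comNzRingType.

Definition finitely_generated (M : lmodType R) : Prop :=
  exists (n : nat) (e : 'I_n -> M),
    forall x : M, exists c : 'I_n -> R, x = \sum_(k < n) c k *: e k.

Definition noetherian : Prop :=
  forall I : submodClosed R^o, finitely_generated (submod I).

Definition maximal_ideal (m : idealr R) : Prop :=
  forall J : idealr R, {subset m <= J} -> J =i m.

Definition local_ring (m : idealr R) : Prop :=
  maximal_ideal m /\ forall J : idealr R, maximal_ideal J -> J =i m.

Definition discrete_valuation_ring (m : idealr R) : Prop :=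
  [/\ GRing.integral_domain_axiom R,
      local_ring m,
      (forall I : submodClosed R^o, exists a : R,
         forall x : R, (x \in I) <-> (exists c : R, x = c * a))
    & exists2 x : R, x \in m & x != 0].

(* There is a chain p_0 < ... < p_d of prime ideals (only the values of [p] at
   0, ..., d matter). *)
Definition prime_chain (d : nat) : Prop :=
  exists p : nat -> prime_idealr R, forall i : nat, (i < d)%N ->
    {subset p i <= p i.+1} /\ exists2 x : R, x \in p i.+1 & x \notin p i.

Definition krull_dim (d : nat) : Prop := prime_chain d /\ ~ prime_chain d.+1.

(* The submodule (s)M. *)
Definition seq_mul (M : lmodType R) (s : seq R) : set M :=
  [set y | exists z : 'I_(size s) -> M, y = \sum_(k < size s) s`_k *: z k].

(* The clause on [k] says that [s`_k] is a nonzerodivisor on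
   M / (s_0, ..., s_(k-1))M, the last one that M / (s)M is nonzero. *)
Definition regular_seq (M : lmodType R) (s : seq R) : Prop :=
  (forall k : nat, (k < size s)%N -> forall y : M,
     seq_mul (take k s) (s`_k *: y) -> seq_mul (take k s) y)
  /\ exists y : M, ~ seq_mul s y.

Definition has_regular_seq (m : idealr R) (M : lmodType R) (d : nat) : Prop :=
  exists s : seq R, [/\ size s = d, {subset s <= m} & regular_seq M s].

(* Prefixes of regular sequences are regular, so [d] is the largest length of
   an [M]-regular sequence in [m].  The zero module has no depth. *)
Definition depth (m : idealr R) (M : lmodType R) (d : nat) : Prop :=
  has_regular_seq m M d /\ ~ has_regular_seq m M d.+1.

(* [m] is meant to be the maximal ideal of a local ring; see [local_ring]. *)
Definition cohen_macaulay (m : idealr R) : Prop :=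
  noetherian /\ exists2 d : nat, krull_dim d & depth m R^o d.

Definition maximal_cohen_macaulay (m : idealr R) (M : lmodType R) : Prop :=
  finitely_generated M /\ exists2 d : nat, krull_dim d & depth m M d.

Definition injective_module (E : lmodType R) : Prop :=
  forall (A B : lmodType R) (f : {linear A -> B}) (g : {linear A -> E}),
    injective f -> exists h : {linear B -> E}, forall x : A, h (f x) = g x.

(* 0 -> M -> E_0 -> E_1 -> ... is exact with all E_i injective. *)
Definition injective_resolution (M : lmodType R) (E : nat -> lmodType R)
    (d : forall i : nat, {linear E i -> E i.+1}) (eps : {linear M -> E 0%N}) :
    Prop :=
  [/\ forall i : nat, injective_module (E i),
      injective eps,
      (forall y : E 0%N, d 0%N y = 0 <-> exists x : M, y = eps x)
    & (forall (i : nat) (y : E i.+1),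
         d i.+1 y = 0 <-> exists x : E i, y = d i x)].

Definition finite_injective_dimension (M : lmodType R) : Prop :=
  exists (E : nat -> lmodType R) (d : forall i : nat, {linear E i -> E i.+1})
         (eps : {linear M -> E 0%N}),
    injective_resolution d eps /\
    exists n : nat, forall i : nat, (n < i)%N -> forall x : E i, x = 0.

(* The coboundaries of degree [t] in Hom(N, E_0) -> Hom(N, E_1) -> ... *)
Definition coboundary (N : lmodType R) (E : nat -> lmodType R)
    (d : forall i : nat, {linear E i -> E i.+1}) (t : nat) :
    (N -> E t) -> Prop :=
  match t return (N -> E t) -> Prop with
  | 0%N => fun f => forall x : N, f x = 0
  | t'.+1 => fun f =>
      exists g : {linear N -> E t'}, forall x : N, f x = d t' (g x)
  end.

Definition trace_ideal (N : lmodType R) : set R :=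
  [set r | exists (n : nat) (phi : 'I_n -> {linear N -> R^o}) (x : 'I_n -> N),
     r = \sum_(k < n) phi k (x k)].

End Rings.

(* The library's quotient ring R/m, as an R-module. *)
Section QuotientModule.
Variables (R : comNzRingType) (m : idealr R).
Implicit Types x y : {ideal_quot m}.

Definition quot_scale (a : R) x : {ideal_quot m} :=
  \pi_({ideal_quot m}) a * x.

Fact quot_scaleA a b x :
  quot_scale a (quot_scale b x) = quot_scale (a * b) x.
Proof. by rewrite /quot_scale mulrA [in RHS]Quotient.pi_mul. Qed.

Fact quot_scale1 : left_id 1 quot_scale.
Proof. by move=> x; rewrite /quot_scale -[RHS]mul1r; congr (_ * _); rewrite piE. Qed.

Fact quot_scaleDr : right_distributive quot_scale +%R.
Proof. by move=> a x y; rewrite /quot_scale mulrDr. Qed.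

Fact quot_scaleDl x : {morph quot_scale^~ x : a b / a + b}.
Proof. by move=> a b; rewrite /quot_scale -mulrDl [in LHS]Quotient.pi_add. Qed.

HB.instance Definition _ := GRing.Zmodule_isLmodule.Build R {ideal_quot m}
  quot_scaleA quot_scale1 quot_scaleDr quot_scaleDl.
End QuotientModule.

Section Canonical.
Variables (R : comNzRingType) (m : idealr R).

(* dim_k Ext^t_R(k, M) = r for k = R/m, where Ext^t_R(k, M) is the degree-t
   cohomology of Hom_R(k, E) for an injective resolution E of M: the classes of
   the cocycles phi_0, ..., phi_(r-1) form a k-basis.  A scalar c in k acts on
   f in Hom_R(k, E_t) by (c f)(x) = f(c x). *)
Definition ext_residue_dim (t : nat) (M : lmodType R) (r : nat) : Prop :=
  exists (E : nat -> lmodType R) (d : forall i : nat, {linear E i -> E i.+1})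
         (eps : {linear M -> E 0%N}),
    injective_resolution d eps /\
    exists phi : 'I_r -> {linear {ideal_quot m} -> E t},
      [/\ forall k x, d t (phi k x) = 0,
          (forall f : {linear {ideal_quot m} -> E t},
             (forall x, d t (f x) = 0) ->
             exists c : 'I_r -> {ideal_quot m},
               coboundary d (fun x => f x - \sum_(k < r) phi k (c k * x)))
        & (forall c : 'I_r -> {ideal_quot m},
             coboundary d (fun x => \sum_(k < r) phi k (c k * x)) ->
             forall k, c k = 0)].

Definition cm_type (M : lmodType R) (r : nat) : Prop :=
  exists2 t : nat, depth m M t & ext_residue_dim t M r.

(* The definition of Bruns and Herzog, for a Cohen-Macaulay local ring (R, m). *)
Definition canonical_module (omega : lmodType R) : Prop :=
  [/\ maximal_cohen_macaulay m omega, cm_type omega 1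
    & finite_injective_dimension omega].
End Canonical.

Section Extensions.
Variable R : comNzRingType.

(* [K], with its structure map from [R], is the total ring of fractions Q(R). *)
Definition total_ring_of_fractions (K : comUnitAlgType R) : Prop :=
  [/\ injective (in_alg K),
      (forall b : R, GRing.lreg b -> (b%:A : K) \is a GRing.unit)
    & (forall z : K, exists a b : R, GRing.lreg b /\ z = a%:A / b%:A)].

Definition conductor (S : comAlgType R) : set R :=
  [set x | forall s : S, exists r : R, x%:A * s = r%:A].

Definition induces_residue_iso (S : comAlgType R) (m : idealr R)
    (n : idealr S) : Prop :=
  exists g : {rmorphism {ideal_quot m} -> {ideal_quot n}},
    (forall x : R, g (\pi_({ideal_quot m}) x) = \pi_({ideal_quot n}) (x%:A : S))
    /\ bijective g.
End Extensions.

(* Main.v *)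
(* The ideal [I S] of the discrete valuation ring [S] is generated by some [x]
   in [I], so for [c] in the conductor [y |-> c * (y / x)] maps [I] to [R] and
   [x] to [c].  This applies to the image of any nonzero functional on a module.
   Some [a] in [m] is a nonzerodivisor on omega; since the conductor is nonzero,
   every nonzero [b] in [R] divides a power of [a] in [R], hence omega is
   torsion-free and has a nonzero functional. *)
Require Import Defs.
From HB Require Import structures.
From mathcomp Require Import all_boot all_algebra.
From mathcomp Require Import boolp classical_sets.

Set Implicit Arguments.
Unset Strict Implicit.
Unset Printing Implicit Defensive.

Import GRing.Theory.
Local Open Scope ring_scope.
Local Open Scope classical_set_scope.

(** * Submodules cut out by classical sets *)

Section SubmodulePredicates.
Variables (R : comNzRingType) (V : lmodType R).

Definition submodule_set (A : set V) : Prop :=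
  A 0 /\ forall a x y, A x -> A y -> A (a *: x + y).

(** The closure proof is an argument so that the structure instance attached to this predicate can
    recover it by unification. *)
Definition submodule_pred (A : set V) of submodule_set A : {pred V} :=
  fun x => `[< A x >].

Fact submodule_pred_closed (A : set V) (AP : submodule_set A) :
  submod_closed (submodule_pred AP).
Proof.
have [A0 AL] := AP.
by split=> [|a x y /asboolP Ax /asboolP Ay]; apply/asboolP; [|exact: AL].
Qed.

HB.instance Definition _ (A : set V) (AP : submodule_set A) :=
  GRing.isSubmodClosed.Build R V (submodule_pred AP) (submodule_pred_closed AP).

End SubmodulePredicates.

(** * Maximal ideals, and units of a local ring *)

Section Ideals.
Variable R : comNzRingType.

Definition proper_ideal_set (A : set R) : Prop :=
  @submodule_set R R^o A /\ ~ A 1.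

Definition proper_ideal_pred (A : set R) of proper_ideal_set A : R -> bool :=
  fun x => `[< A x >].

Fact proper_ideal_pred_closed (A : set R) (AP : proper_ideal_set A) :
  idealr_closed (proper_ideal_pred AP).
Proof.
have [[A0 AL] A1] := AP; split; [exact/asboolP|exact/asboolP|].
by move=> a x y /asboolP Ax /asboolP Ay; apply/asboolP; apply: AL.
Qed.

HB.instance Definition _ (A : set R) (AP : proper_ideal_set A) :=
  isIdealr.Build R (proper_ideal_pred AP) (proper_ideal_pred_closed AP).

Lemma idealr_proper_ideal_set (J : idealr R) : proper_ideal_set [set` J].
Proof.
split=> [|/=]; last by rewrite idealr1.
by split=> /= [|a x y Jx Jy]; [exact: rpred0|rewrite rpredD // idealMr].
Qed.

Lemma exists_maximal_ideal (u : R) : (forall v, u * v <> 1) ->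
  exists2 J : idealr R, maximal_ideal J & u \in J.
Proof.
move=> nu; pose U : set R := [set x | exists v, x = u * v].
have QU : proper_ideal_set U.
  split=> [|[v /esym/nu//]]; split=> [|a _ _ [v ->] [w ->]].
    by exists 0; rewrite mulr0.
  by exists (a * v + w); rewrite mulrDr mulrCA.
(* Chains in [Zorn_bigcup] may be empty, so [U] is added to every set [A]. *)
have [F FQ totF|A [QA Amax]] :=
    @Zorn_bigcup R [set A | proper_ideal_set (A `|` U)].
  have [[U0 UL] U1] := QU; split; last first.
    by case=> [[X FX X1]|//]; have [_] := FQ X FX; apply; left.
  split=> [|a x y]; first by right.
  have step X : F X -> (X `|` U) x -> (X `|` U) y ->
      (\bigcup_(X in F) X `|` U) (a *: (x : R^o) + y).
    move=> FX Xx Xy; have [[_ XL] _] := FQ X FX.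
    by case: (XL a x y Xx Xy) => H; [left; exists X|right].
  move=> [[X FX Xx]|Ux] [[Y FY Yy]|Uy].
  - case: (totF X Y FX FY) => XY.
      by apply: (step Y); [|left; apply: XY|left].
    by apply: (step X); [|left|left; apply: XY].
  - by apply: (step X); [|left|right].
  - by apply: (step Y); [|right|left].
  - by right; apply: UL.
pose J : idealr R := proper_ideal_pred QA.
have JP x : (x \in J) <-> (A `|` U) x by split=> /asboolP.
exists J; last by apply/JP; right; exists 1; rewrite mulr1.
move=> J' sJ x; apply/idP/idP=> [J'x|/sJ//].
(* If [x] were outside [J], then [J'] would strictly contain [A]. Since [J'] contains [U], adding
   [U] to it changes nothing, so it would contradict the maximality of [A]. *)
apply: contrapT => nJx; apply: (Amax [set` J']).
  split=> [y Ay /=|sJ'A]; first by apply/sJ/JP; left.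
  by apply/nJx/JP; left; apply: sJ'A.
rewrite /= setUidl; first exact: idealr_proper_ideal_set.
by move=> y Uy /=; apply/sJ/JP; right.
Qed.

Lemma local_ring_unit (n : idealr R) (x : R) :
  local_ring n -> x \notin n -> exists y, x * y = 1.
Proof.
move=> [_ uniq_n] nx; apply: contrapT => /forallNP /exists_maximal_ideal.
by case=> J /uniq_n Jn; rewrite Jn (negPf nx).
Qed.

End Ideals.

(** * Divisibility in a discrete valuation ring *)

Section DVR.
Variables (S : comNzRingType) (n : idealr S).
Hypothesis S_DVR : discrete_valuation_ring n.

Lemma dvr_mulf_eq0 (x y : S) : x * y = 0 -> x = 0 \/ y = 0.
Proof.
by case: S_DVR => dom _ _ _ /dom /orP[]/eqP; [left|right].
Qed.

Lemma dvr_mulfI (x y z : S) : x != 0 -> x * y = x * z -> y = z.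
Proof.
move=> x0 /eqP; rewrite -subr_eq0 -mulrBr => /eqP/dvr_mulf_eq0[/eqP|/eqP].
  by rewrite (negPf x0).
by rewrite subr_eq0 => /eqP.
Qed.

(* The ideal generated by [A] is principal, and in a local ring a generator can
   be chosen in [A]. *)
Lemma dvr_min_divisor (A : set S) : A !=set0 ->
  exists2 x, A x & forall y, A y -> exists s, y = s * x.
Proof.
move=> [x0 Ax0]; have [_ locn prin _] := S_DVR.
pose G : set S := [set y | exists (k : nat) (c a : 'I_k -> S),
  (forall i, A (a i)) /\ y = \sum_(i < k) c i * a i].
have GP : @submodule_set S S^o G.
  split=> [|b x y [k [c [a [Aa ->]]]] [l [d [e [Ae ->]]]]].
    exists 0%N, (fun _ => 0), (fun _ => 0).
    by split=> [[]//|]; rewrite big_ord0.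
  exists (k + l)%N.
  exists (fun i => match split i with inl i => b * c i | inr i => d i end).
  exists (fun i => match split i with inl i => a i | inr i => e i end).
  split=> [i|]; first by case: (split i).
  rewrite big_split_ord /=; congr (_ + _).
    rewrite [LHS]mulr_sumr; apply: eq_bigr => i _.
    case: split_ordP => j; first by move/lshift_inj=> <-; rewrite mulrA.
    by move/eqP; rewrite eq_lrshift.
  apply: eq_bigr => i _.
  case: split_ordP => j; last by move/rshift_inj=> <-.
  by move/eqP; rewrite eq_rlshift.
pose I : submodClosed S^o := submodule_pred GP.
have [g gP] := prin I.
have AG y : A y -> exists s, y = s * g.
  move=> Ay; apply/gP/asboolP; exists 1%N, (fun _ => 1), (fun _ => y).
  by split=> //; rewrite big_ord1 mul1r.
have [g0|g0] := eqVneq g 0.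
  exists x0 => // y /AG[s ->]; have [t ->] := AG _ Ax0.
  by exists 0; rewrite g0 !mulr0.
have /asboolP[k [c [a [Aa gE]]]] : g \in I by apply/gP; exists 1; rewrite mul1r.
have /choice[d dE] : forall i, exists s, a i = s * g by move=> i; apply: AG.
(* Cancelling [g] from its own expansion writes 1 as a combination of the [d i]. Hence some [d i] is
   a unit, and the matching [a i] is an associate of [g]. *)
have cd1 : \sum_(i < k) c i * d i = 1.
  apply: (@dvr_mulfI g) => //; rewrite mulr1 [RHS]gE mulr_sumr.
  by apply: eq_bigr => i _; rewrite dE mulrC mulrA.
have [i di] : exists i, d i \notin n.
  apply: contrapT => /forallNP dn; have := idealr1 n.
  rewrite -cd1 rpred_sum // => i _; apply: idealMr.
  by apply: contrapT => /negP /dn.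
have [v dv] := local_ring_unit locn di.
exists (a i) => // y /AG[s ->]; exists (s * v).
by rewrite dE mulrA -(mulrA s) (mulrC v) dv mulr1.
Qed.

(** Of two elements of [S] one divides the other, so [d] divides any power of [a] that does not
    divide [d]. Such a power exists because the powers of [a] have no nonzero common multiple. *)
Lemma dvr_dvd_exp (a d : S) : a \in n -> d != 0 ->
  exists (N : nat) (s : S), a ^+ N = d * s.
Proof.
move=> an d0; have [_ _ prin _] := S_DVR.
have [[N H]|/forallNP H] := pselect (exists N, ~ exists s, d = a ^+ N * s).
  have [|x Ax xP] := @dvr_min_divisor [set d; a ^+ N]; first by exists d; left.
  case: Ax => xE; rewrite {}xE in xP.
    by exists N; have [|s ->] := xP (a ^+ N); [right|exists s; rewrite mulrC].
  by case: H; have [|s ->] := xP d; [left|exists s; rewrite mulrC].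
(* Otherwise [d] lies in the intersection of the ideals [(a ^+ N)], whose
   generator [g] is then a multiple of [a * g]. *)
have {H}dP N : exists s, d = a ^+ N * s by apply: contrapT.
have pP : @submodule_set S S^o [set x | forall N, exists s, x = a ^+ N * s].
  split=> [N|b x y Hx Hy N].
    by exists 0; rewrite mulr0.
  have [s ->] := Hx N; have [t ->] := Hy N; exists (b * s + t).
  by rewrite mulrDr mulrCA.
pose I : submodClosed S^o := submodule_pred pP.
have [g gP] := prin I.
have [c dE] : exists c, d = c * g by apply/gP/asboolP.
have g0 : g != 0 by apply: contraNneq d0 => g0; rewrite dE g0 mulr0.
have /asboolP gI : g \in I by apply/gP; exists 1; rewrite mul1r.
have [q qE] := gI 1%N; rewrite expr1 in qE.
have a0 : a != 0 by apply: contraNneq g0 => a0; rewrite qE a0 mul0r.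
(* The quotient [q] of [g] by [a] lies in every [(a ^+ N)], because [g] lies in [(a ^+ N.+1)]. So
   [g] divides [q], which makes [a] a unit. *)
have [w wE] : exists w, q = w * g.
  apply/gP/asboolP => N; have [s sE] := gI N.+1; exists s.
  by apply: (dvr_mulfI a0); rewrite -qE sE exprS mulrA.
have aw : a * w = 1.
  by apply: (dvr_mulfI g0); rewrite mulr1 [RHS]qE wE mulrC mulrA.
by have := idealr1 n; rewrite -aw mulrC idealMr.
Qed.

End DVR.

(** * Functionals on torsion-free modules *)

Section Functionals.
Variables (R : comNzRingType) (M : lmodType R).

(** Allows a functional to be specified by an equation for its values, as is needed for quotients in
    a ring without division. *)
Lemma linear_of_relation (P : M -> R -> Prop) :
  (forall y, exists r, P y r) ->
  (forall y r r', P y r -> P y r' -> r = r') ->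
  (forall a y z r s, P y r -> P z s -> P (a *: y + z) (a * r + s)) ->
  exists f : {linear M -> R^o}, forall y, P y (f y).
Proof.
move=> /choice[f fP] Puniq Plin.
have fL : linear (f : M -> R^o) by move=> a y z; apply: Puniq (fP _) (Plin _ _ _ _ _ _ _).
pose g : {linear M -> R^o} :=
  HB.pack (f : M -> R^o) (GRing.isLinear.Build R M R^o *:%R f fL).
by exists g.
Qed.

Hypothesis R_domain : forall a b : R, a * b = 0 -> a = 0 \/ b = 0.
Hypothesis M_torsion_free : forall (a : R) (y : M), a != 0 -> a *: y = 0 -> y = 0.

Lemma prod_domain_neq0 (I : finType) (b : I -> R) :
  (forall i, b i != 0) -> \prod_i b i != 0.
Proof.
move=> b0; apply: (big_ind (fun x => x != 0)) => [|x y x0 y0|i _ //].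
  exact: oner_neq0.
by apply/eqP => /R_domain[] /eqP; apply/negP.
Qed.

(* A nonzero multiple of [M] lies in the free span of a maximal independent set
   of generators; the functional is one of the coordinates there. *)
Lemma torsion_free_functional : finitely_generated M -> (exists y : M, y != 0) ->
  exists (f : {linear M -> R^o}) (y : M), f y != 0.
Proof.
move=> [n [e gen]] [y0 y0N0].
pose free (B : {set 'I_n}) := `[< forall c : 'I_n -> R,
  \sum_(k in B) c k *: e k = 0 -> forall k, k \in B -> c k = 0 >].
have free0 : free finset.set0 by apply/asboolP => c _ k; rewrite inE.
have [B /asboolP freeB Bmax] := @arg_maxnP _ finset.set0 free (fun B => #|B|) free0.
have dep i : exists b : R, b != 0 /\
    exists d : 'I_n -> R, b *: e i = \sum_(k in B) d k *: e k.
  have [iB|niB] := boolP (i \in B).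
    exists 1; split; first exact: oner_neq0.
    exists (fun k => (k == i)%:R); rewrite scale1r (bigD1 i) //= eqxx scale1r.
    by rewrite big1 ?addr0 // => k /andP[_ /negPf->]; rewrite scale0r.
  (* By maximality of [B], adding [i] creates a nontrivial relation. Its coefficient at [i] is
     nonzero, or else it would be a relation on [B] alone. *)
  have /asboolPn /existsNP[c /not_implyP[cE /existsNP[k /not_implyP[kB ck]]]] :
      ~~ free (i |: B).
    by apply/negP => /Bmax; rewrite /= cardsU1 niB add1n ltnn.
  rewrite big_setU1 //= in cE.
  exists (c i); split.
    apply/eqP => ci0; apply: ck; case/setU1P: kB => [->//|kB].
    by apply: freeB kB; rewrite ci0 scale0r add0r in cE.
  exists (fun k => - c k); under eq_bigr do rewrite scaleNr.
  by rewrite sumrN; apply/eqP; rewrite -addr_eq0 cE.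
have /choice[b bP] := dep.
pose t := \prod_i b i.
have t0 : t != 0 by apply: prod_domain_neq0 => i; have [] := bP i.
have tM y : exists d : 'I_n -> R, t *: y = \sum_(k in B) d k *: e k.
  have [c ->] := gen y.
  have /choice[d dE] : forall i, exists d : 'I_n -> R,
      b i *: e i = \sum_(k in B) d k *: e k by move=> i; have [] := bP i.
  (* In [t *: (c i *: e i)] the factor [b i] of [t] moves [e i] into the span, and the other factors
     remain as coefficients. *)
  exists (fun k => \sum_i (\prod_(i' | i' != i) b i') * c i * d i k).
  rewrite scaler_sumr; under [RHS]eq_bigr do rewrite scaler_suml.
  rewrite exchange_big; apply: eq_bigr => i _ /=.
  under [RHS]eq_bigr do rewrite -scalerA.
  rewrite -scaler_sumr -dE !scalerA; congr (_ *: _).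
  by rewrite /t (bigD1 i) //= -!mulrA mulrC -!mulrA.
have [i iB] : exists i, i \in B.
  apply/finset.set0Pn/eqP => B0; move/eqP: y0N0; apply.
  by apply: (M_torsion_free t0); have [d ->] := tM y0; rewrite B0 finset.big_set0.
(* The functional sends [y] to the [i]-th coordinate of [t *: y], which is unique since [B] is
   independent. *)
pose P y r := exists d : 'I_n -> R,
  t *: y = \sum_(k in B) d k *: e k /\ d i = r.
have [y|y _ _ [d [dE <-]] [d' [dE' <-]]|a y z _ _ [d [dE <-]] [d' [dE' <-]]|f fP] :=
  @linear_of_relation P.
- by have [d dE] := tM y; exists (d i), d.
- apply/eqP; rewrite -subr_eq0; apply/eqP.
  apply: (freeB (fun k => d k - d' k)) iB.
  by under eq_bigr do rewrite scalerBl; rewrite sumrB -dE -dE' subrr.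
- exists (fun k => a * d k + d' k); split=> //.
  under eq_bigr do rewrite scalerDl -scalerA.
  by rewrite big_split /= -scaler_sumr -dE -dE' scalerDr scalerA mulrC -scalerA.
exists f, (e i); have [d [dE <-]] := fP (e i).
(* By independence, the [i]-th coordinate of [t *: e i] is [t]. *)
apply: contraNneq t0 => di0.
suff: (if i == i then t else 0) - d i = 0 by rewrite eqxx di0 subr0 => ->.
apply: (freeB (fun k => (if k == i then t else 0) - d k)) (iB).
under eq_bigr do rewrite scalerBl; rewrite sumrB -dE.
rewrite (bigD1 i) //= eqxx big1 ?addr0 ?subrr // => k /andP[_ /negPf->].
by rewrite scale0r.
Qed.

End Functionals.

(** * The conductor, traces and torsion *)

Section ConductorTrace.
Variables (R : comNzRingType) (S : comAlgType R) (n : idealr S).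
Hypotheses (S_DVR : discrete_valuation_ring n) (R_sub_S : injective (in_alg S)).

Lemma subalg_dvr_domain (a b : R) : a * b = 0 -> a = 0 \/ b = 0.
Proof.
move=> ab0; have /(dvr_mulf_eq0 S_DVR)[] : in_alg S a * in_alg S b = 0.
- by rewrite -rmorphM ab0 rmorph0.
- by rewrite -[0](rmorph0 (in_alg S)) => /R_sub_S; left.
- by rewrite -[0](rmorph0 (in_alg S)) => /R_sub_S; right.
Qed.

Lemma conductor_sub_trace_functional (M : lmodType R)
    (phi : {linear M -> R^o}) (y0 : M) :
  phi y0 != 0 -> conductor S `<=` trace_ideal M.
Proof.
move=> phiy0 c cC.
have [|_ [z _ <-] zP] := dvr_min_divisor S_DVR (A := range (fun y => in_alg S (phi y))).
  by exists (in_alg S (phi y0)), y0.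
have phiz : phi z != 0.
  apply: contraNneq phiy0 => phiz; have [|s] := zP (in_alg S (phi y0)).
    by exists y0.
  by rewrite phiz rmorph0 mulr0 -[0](rmorph0 (in_alg S)) => /R_sub_S ->.
have phizI (r r' : R) : r * phi z = r' * phi z -> r = r'.
  move=> /eqP; rewrite -subr_eq0 -mulrBl => /eqP/subalg_dvr_domain[/eqP|/eqP].
    by rewrite subr_eq0 => /eqP.
  by rewrite (negPf phiz).
(* The value of [psi] at [y] is [c * (phi y / phi z)]: the quotient lies in [S] by the choice of
   [z], and [c] carries it into [R]. *)
have [y|y r r' E E'|a y y' r s Er Es|psi psiP] :=
  @linear_of_relation R M (fun y r => r * phi z = c * phi y).
- have [|s sE] := zP (in_alg S (phi y)); first by exists y.
  have [r rE] := cC s; exists r; apply: R_sub_S.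
  by rewrite !rmorphM /= -!in_algE sE mulrA [in RHS]in_algE rE.
- by apply: phizI; rewrite E E'.
- by rewrite linearP mulrDl -mulrA Er Es mulrDr mulrCA.
exists 1%N, (fun _ => psi), (fun _ => z); rewrite big_ord1.
by apply: phizI; rewrite psiP.
Qed.

(** The generators of [S] are fractions over [R], and the product of their denominators multiplies
    all of [S] into [R]. *)
Lemma conductor_neq0 (K : comUnitAlgType R) (j : {lrmorphism S -> K}) :
  finitely_generated S -> total_ring_of_fractions K -> injective j ->
  exists2 b : R, conductor S b & b != 0.
Proof.
move=> [k [e gen]] [_ regK fracK] jI.
have /choice[b bP] : forall i, exists b : R,
    b != 0 /\ exists a : R, b%:A * e i = a%:A.
  move=> i; have [a [b [breg jE]]] := fracK (j (e i)).
  exists b; split.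
    apply/eqP => b0; have /eqP := oner_neq0 R; apply; apply: breg.
    by rewrite b0 !mul0r.
  exists a; apply: jI; rewrite rmorphM /= !rmorph_alg jE mulrC divrK //.
  exact: regK.
have /choice[a aE] : forall i, exists a : R, (b i)%:A * e i = a%:A.
  by move=> i; have [] := bP i.
exists (\prod_i b i); last first.
  by apply: (prod_domain_neq0 subalg_dvr_domain) => i; have [] := bP i.
move=> s; have [c ->] := gen s.
exists (\sum_i (\prod_(i' | i' != i) b i') * c i * a i).
rewrite scaler_suml mulr_sumr; apply: eq_bigr => i _.
rewrite -[RHS]scalerA -aE -!scalerAl !mul1r !scalerA; congr (_ *: _).
by rewrite (bigD1 i) //= -!mulrA mulrC -!mulrA.
Qed.

(** For a nonzero [c] in the conductor, [b * c] divides some [a ^+ N] in [S], with cofactor [s]. As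
    [c * s] lies in [R], [b] divides [a ^+ N] already in [R], so [b *: y = 0] forces
    [a ^+ N *: y = 0]. *)
Lemma regular_torsion_free (K : comUnitAlgType R) (j : {lrmorphism S -> K})
    (M : lmodType R) (a : R) :
  finitely_generated S -> total_ring_of_fractions K -> injective j ->
  (a%:A : S) \in n -> (forall y : M, a *: y = 0 -> y = 0) ->
  forall (b : R) (y : M), b != 0 -> b *: y = 0 -> y = 0.
Proof.
move=> S_fin K_frac jI an a_reg b y b0 by0.
have [c cC c0] := conductor_neq0 S_fin K_frac jI.
have bc0 : (b * c)%:A != 0 :> S.
  apply/eqP => /=; rewrite -in_algE -(rmorph0 (in_alg S)) => /R_sub_S.
  by case/subalg_dvr_domain => /eqP; apply/negP.
have [N [s aN]] := dvr_dvd_exp S_DVR an bc0.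
have [r rE] := cC s.
have aNE : a ^+ N = r * b.
  apply: R_sub_S; rewrite rmorphXn /= aN -!in_algE rmorphM /= -mulrA rE mulrC.
  by rewrite -in_algE -rmorphM.
have : a ^+ N *: y = 0 by rewrite aNE -scalerA by0 scaler0.
elim: N {aN aNE} => [|N IH]; first by rewrite expr0 scale1r.
by rewrite exprS -scalerA => /a_reg.
Qed.

End ConductorTrace.

(** * Application to the canonical module *)

Lemma mcm_regular_element (R : comNzRingType) (m : idealr R) (M : lmodType R) :
  prime_chain R 1 -> maximal_cohen_macaulay m M ->
  exists2 a : R, a \in m & (forall y : M, a *: y = 0 -> y = 0) /\
    exists y : M, y != 0.
Proof.
move=> chain1 [_ [[|d] [_ no_chain] [[s [sz sm [reg [y yN]]]] _]]].
  (* Depth zero would mean dimension zero, against the chain of two primes. *)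
  by case: no_chain.
exists s`_0; first by apply: sm; rewrite mem_nth // sz.
split=> [z z0|]; last first.
  exists y; apply: contra_notN yN => /eqP->; exists (fun _ => 0).
  by rewrite big1 // => k _; rewrite scaler0.
have size_s : (0 < size s)%N by rewrite sz.
(* At index 0 the prefix is empty and generates the zero submodule, so regularity says that the
   first element kills no nonzero vector. *)
have := reg 0%N size_s z; rewrite take0 z0 => reg0.
by have [|w ->] := reg0; [exists (fun _ => 0)|]; rewrite big_ord0.
Qed.

(** The residue map sends the zero class of [a] to zero. This places a regular element from [m] in
    [n], as [dvr_dvd_exp] requires. *)
Lemma residue_iso_mem (R : comNzRingType) (S : comAlgType R) (m : idealr R)
    (n : idealr S) (a : R) :
  induces_residue_iso m n -> a \in m -> (a%:A : S) \in n.
Proof.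
move=> [g [gE _]] am; rewrite -[_%:A]subr0 Quotient.idealrBE -gE.
have -> : (\pi_({ideal_quot m}) a = \pi_({ideal_quot m}) 0)%qT.
  by apply/eqP; rewrite -Quotient.idealrBE subr0.
by rewrite gE scale0r.
Qed.

(** The ideal [I] is taken nonzero: the zero ideal has trace zero, whereas the conductor is nonzero
    by [conductor_neq0]. The embedding [j] into [K] expresses that [S] lies in the total ring of
    fractions of [R]. *)
Theorem propositionA1
  (R : comNzRingType) (m : idealr R) (omega : lmodType R)
  (S : comAlgType R) (n : idealr S)
  (K : comUnitAlgType R) (j : {lrmorphism S -> K})
  (R_local : local_ring m)
  (R_CM : cohen_macaulay m)
  (R_dim1 : krull_dim R 1)
  (omega_canonical : canonical_module m omega)
  (R_sub_S : injective (in_alg S))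
  (S_finite : finitely_generated S)
  (S_DVR : discrete_valuation_ring n)
  (K_fractions : total_ring_of_fractions K)
  (S_sub_K : injective j)
  (residue_iso : induces_residue_iso m n) :
  (forall I : submodClosed R^o, (exists2 x : R, x \in I & x != 0) ->
     conductor S `<=` trace_ideal (submod I))
  /\ conductor S `<=` trace_ideal omega.
Proof.
split=> [I [x xI x0]|].
  (* For an ideal the inclusion into [R] is already a nonzero functional. *)
  pose incl : {linear submod I -> R^o} := val.
  exact: (conductor_sub_trace_functional S_DVR R_sub_S
            (phi := incl) (y0 := Submod xI)).
have [omega_MCM _ _] := omega_canonical.
have [a am [a_reg omega0]] := mcm_regular_element R_dim1.1 omega_MCM.
have tf := regular_torsion_free S_DVR R_sub_S S_finite K_fractions S_sub_K
  (residue_iso_mem residue_iso am) a_reg.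
have [phi [y phiy]] := torsion_free_functional
  (subalg_dvr_domain S_DVR R_sub_S) tf omega_MCM.1 omega0.
exact: (conductor_sub_trace_functional S_DVR R_sub_S phiy).
Qed.
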